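(* In a path-balanced binary search tree on $n$ nodes, the amortized time of an access (successful search) is $O\left(\log n \cdot (\log^{\ast} n)^2 \cdot 2^{\log^{\ast} n}\right)$.
   Context: A path-balanced BST is a binary search tree (distinct keys) maintained as follows. To access an item $x$, follow the search path from the root to $x$; the actual cost is the number of nodes on this path. Afterwards the search path is re-arranged into a complete balanced BST on the nodes of the path (all levels complete except possibly the lowest), occupying the position of the old path, and the subtrees that hung off the search path are re-attached in the unique way determined by the key order. Amortized time is in the standard sense of amortized analysis over sequences of accesses. $\log^{\ast}$ is the iterated logarithm; $\log$ is base 2. *)

(* Defs.v *)
From mathcomp Require Import all_boot all_order all_algebra.
From mathcomp Require Import reals exp.

Set Implicit Arguments.
Unset Strict Implicit.
Unset Printing Implicit Defensive.

Import Order.TTheory GRing.Theory Num.Theory.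

Local Open Scope order_scope.

Inductive bst (K : Type) : Type :=
| Leaf
| Node of bst K & K & bst K.
Arguments Leaf {K}.

Section Trees.
Variable K : Type.
Implicit Types t b : bst K.

Fixpoint inorder t : seq K :=
  if t is Node l k r then inorder l ++ k :: inorder r else [::].

Definition size_bst t : nat := size (inorder t).

Fixpoint height t : nat :=
  if t is Node l _ r then (maxn (height l) (height r)).+1 else 0.

(* The root is at level 0, and the levels of t are 0, ..., (height t).-1. *)
Fixpoint level_size t (i : nat) : nat :=
  match t, i with
  | Leaf, _ => 0
  | Node _ _ _, 0 => 1
  | Node l _ r, j.+1 => level_size l j + level_size r j
  end.

(* The lowest level may have its nodes at arbitrary positions. *)
Definition complete_bst t : Prop :=
  forall i : nat, (i.+1 < height t)%N -> level_size t i = (2 ^ i)%N.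

(* Replaces the (size_bst b).+1 leaves of b, from left to right, by the trees
   of the sequence ts. *)
Fixpoint graft b (ts : seq (bst K)) : bst K :=
  if b is Node l k r then
    Node (graft l (take (size_bst l).+1 ts)) k
         (graft r (drop (size_bst l).+1 ts))
  else head Leaf ts.

End Trees.

Section SearchTrees.
Variables (d : Order.disp_t) (K : orderType d).
Implicit Types (t b : bst K) (x : K).

Definition is_bst t : bool := sorted <%O (inorder t).

Fixpoint search_path x t : seq K :=
  if t is Node l k r then
    k :: (if x == k then [::]
          else if x < k then search_path x l else search_path x r)
  else [::].

(* The subtrees that hang off the search path of x, including the two subtrees
   of the node x itself and the empty ones, in increasing order of their keys.
   When x occurs in t, there is one more of them than nodes on the path. *)
Fixpoint hanging_subtrees x t : seq (bst K) :=
  if t is Node l k r then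
    if x == k then [:: l; r]
    else if x < k then rcons (hanging_subtrees x l) r
    else l :: hanging_subtrees x r
  else [:: Leaf].

(* A relation rather than a function: the re-arranged path b is any complete
   search tree on the nodes of the path.  As both the leaves of b and the
   hanging subtrees are listed from left to right, grafting the latter is the
   only re-attachment that respects the key order. *)
Definition path_balance_access x t t' : Prop :=
  x \in inorder t /\
  exists b : bst K,
    [/\ complete_bst b, is_bst b, perm_eq (inorder b) (search_path x t)
      & t' = graft b (hanging_subtrees x t)].

(* [path_balance_run t xs t' c]: starting from t, accessing the items of xs in
   this order can lead to t', with total actual cost c. *)
Inductive path_balance_run : bst K -> seq K -> bst K -> nat -> Prop :=
| run_nil t : path_balance_run t [::] t 0
| run_cons t x t' xs t'' c :
    path_balance_access x t t' -> path_balance_run t' xs t'' c ->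
    path_balance_run t (x :: xs) t'' (size (search_path x t) + c).

End SearchTrees.

Local Open Scope ring_scope.

Definition log2 (R : realType) (x : R) : R := ln x / ln 2.

Lemma log_star_subproof (R : realType) (x : R) :
  exists k : nat, iter k (@log2 R) x <= 1.
Proof.
have [m lexm] : exists m : nat, x <= m.+1%:R.
  by exists (Num.truncn x); apply/ltW/truncnS_gt.
elim: m x lexm => [|m IHm] x lexm; first by exists 0%N.
have [x_le1|x_gt1] := leP x 1; first by exists 0%N.
have ln2_gt0 : 0 < ln 2 :> R by rewrite ln_gt0 // ltr1n.
have x_gt0 : 0 < x by apply: lt_trans x_gt1.
have [|k lek] := IHm (log2 x); last by exists k.+1; rewrite iterSr.
rewrite /log2 ler_pdivrMr // mulr_natl -lnXn ?ltr0n //.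
rewrite ler_ln ?posrE ?exprn_gt0 ?ltr0n //.
by apply: le_trans lexm _; rewrite -natrX ler_nat ltn_expl.
Qed.

(* The least number of applications of log2 that bring x down to at most 1;
   up to that point log2 is only applied to reals above 1. *)
Definition log_star (R : realType) (x : R) : nat :=
  ex_minn (log_star_subproof x).

(* Main.v *)
(* Give a node whose subtrees have p and q leaves the potential
   sum_(i < log* n) min (rho, h_i) / h_(i+1), where rho = |log2 p - log2 q| and
   h_i = max 1 (log2^(i+1) n).  Balancing a path that turns always to the same
   side amounts to rounds of links between neighbouring path nodes.  A link
   in front of a light remainder raises the potential by at most a constant
   times that of D, the logarithm of the factor by which the weight below the
   path drops; D sums up to at most log2 n over a round, and as the slope of
   the potential is 1 / h_(i+1) on scale h_i, the about h_(i+1) rounds in which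
   scale i matters contribute O(log n).  A link in front of a heavy remainder
   never raises the potential: if both nodes have rho <= h_i, then it either
   gains 1 or leaves a path node with rho <= h_(i+1).  Hence after log* n rounds
   every surviving node accounts for a constant gain, and a path of k nodes
   gains about k / 2^(log* n).  The rounds with more than log2 n links are what
   costs the second factor log* n.  A search path first splits into its
   left and its right turns, and this too is paid by the sum of the D. *)

Require Import Defs.
From mathcomp Require Import all_boot all_order all_algebra.
From mathcomp Require Import reals exp.
From mathcomp Require Import ring lra zify.

Set Implicit Arguments.
Unset Strict Implicit.
Unset Printing Implicit Defensive.

Import Order.TTheory GRing.Theory Num.Theory.
Local Open Scope ring_scope.

(** * The binary logarithm *)

Section BinaryLogarithm.
Variable R : realType.
Implicit Types x y z : R.

Lemma ln2_gt0 : 0 < ln 2 :> R.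
Proof. by rewrite ln_gt0 // ltr1n. Qed.

Lemma log2_1 : log2 (1 : R) = 0.
Proof. by rewrite /log2 ln1 mul0r. Qed.

Lemma log2_2 : log2 (2 : R) = 1.
Proof. by rewrite /log2 divff // gt_eqF // ln2_gt0. Qed.

Lemma log2M x y : 0 < x -> 0 < y -> log2 (x * y) = log2 x + log2 y.
Proof. by move=> x0 y0; rewrite /log2 lnM ?posrE // mulrDl. Qed.

Lemma log2V x : 0 < x -> log2 x^-1 = - log2 x.
Proof. by move=> x0; rewrite /log2 lnV ?posrE // mulNr. Qed.

Lemma log2X k : log2 (2 ^+ k : R) = k%:R.
Proof.
rewrite /log2 lnXn // -[_ *+ k]mulr_natl mulfK //.
by rewrite gt_eqF // ln2_gt0.
Qed.

Lemma ler_log2 x y : 0 < x -> x <= y -> log2 x <= log2 y.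
Proof.
move=> x0 xy; rewrite ler_pM2r ?invr_gt0 ?ln2_gt0 // ler_ln ?posrE //.
exact: lt_le_trans xy.
Qed.

Lemma ltr_log2 x y : 0 < x -> x < y -> log2 x < log2 y.
Proof.
move=> x0 xy; rewrite ltr_pM2r ?invr_gt0 ?ln2_gt0 // ltr_ln ?posrE //.
exact: lt_trans xy.
Qed.

Lemma ler_log2M x y z : 0 < x -> 0 < y -> 0 < z -> z <= x * y ->
  log2 z <= log2 x + log2 y.
Proof. by move=> x0 y0 z0 le_z; rewrite -log2M // ler_log2. Qed.

Lemma log2_ge0 x : 1 <= x -> 0 <= log2 x.
Proof. by move=> x1; rewrite -log2_1 ler_log2. Qed.

Lemma log2_le0 x : x <= 1 -> log2 x <= 0.
Proof.
by move=> x1; rewrite pmulr_lle0 ?invr_gt0 ?ln2_gt0 // ln_le0.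
Qed.

Lemma ln2_ge_half : 1 / 2 <= ln 2 :> R.
Proof.
have : ln (2^-1 : R) <= - 2^-1.
  have {1}-> : (2^-1 : R) = 1 + (- 2^-1) by field.
  by apply: le_ln1Dx; lra.
rewrite lnV ?posrE //; lra.
Qed.

Lemma log2_le_double x : 0 < x -> log2 x <= 2 * x.
Proof.
move=> x0; rewrite ler_pdivrMr ?ln2_gt0 //.
have := ln_sublinear x0; have := ln2_ge_half; nra.
Qed.

End BinaryLogarithm.

(** * The potential of a node and the effect of a single link *)

Lemma ler_sum_const (R : numDomainType) (k : nat) (F : 'I_k -> R) (x : R) :
  (forall i, F i <= x) -> \sum_(i < k) F i <= k%:R * x.
Proof.
move=> le_x; rewrite mulr_natl -[k in leRHS]card_ord -sumr_const.
by apply: ler_sum => i _.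
Qed.

(* h i stands for max 1 (log2^(i+1) n), and r for log* n. *)
Section Gauge.
Variables (R : realType) (r : nat) (h : nat -> R).
Hypothesis r_gt0 : (0 < r)%N.
Hypothesis h_ge1 : forall i, 1 <= h i.
Hypothesis h_last : forall i, (r.-1 <= i)%N -> h i = 1.

Implicit Types x y D a b c p q : R.

(* gauge 0 is the potential of a node of imbalance x, and gauge l bounds the sum
   of gauge 0 over any 2^l nonnegative reals of sum x. *)
Definition gauge (l : nat) x : R :=
  \sum_(i < r) Num.min x (2 ^+ l * h i) / h i.+1.

Let h_gt0 i : 0 < h i.
Proof. exact: lt_le_trans (h_ge1 i). Qed.

Lemma gaugeP l x y z :
  (forall i, Num.min x (2 ^+ l * h i) <= Num.min y (2 ^+ l * h i) + Num.min z (2 ^+ l * h i)) ->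
  gauge l x <= gauge l y + gauge l z.
Proof.
move=> le; rewrite /gauge -big_split /=; apply: ler_sum => i _.
by rewrite -mulrDl ler_pM2r ?invr_gt0.
Qed.

Lemma ler_gauge l x y : x <= y -> gauge l x <= gauge l y.
Proof.
move=> xy; apply: ler_sum => i _; rewrite ler_pM2r ?invr_gt0 //.
by rewrite le_min !ge_min xy lexx orbT.
Qed.

Lemma gauge_ge0 l x : 0 <= x -> 0 <= gauge l x.
Proof.
move=> x0; apply: sumr_ge0 => i _; apply: divr_ge0; last exact: ltW.
by rewrite le_min x0 /= mulr_ge0 ?exprn_ge0 // ltW.
Qed.

(** The cap doubles with the level: truncating two reals at [v] loses at least as much as truncating
    their sum at [2 * v]. *)
Lemma gauge_split l x y : 0 <= x -> 0 <= y ->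
  gauge l x + gauge l y <= gauge l.+1 (x + y).
Proof.
move=> x0 y0; rewrite /gauge -big_split /=; apply: ler_sum => i _.
rewrite -mulrDl ler_pM2r ?invr_gt0 // exprS.
have := h_gt0 i; have : 0 < 2 ^+ l :> R by rewrite exprn_gt0.
move: (2 ^+ l) (h i) => e u e0 u0; have : 0 < e * u by rewrite mulr_gt0.
rewrite -mulrA; move: (e * u) => v v0.
by rewrite /Num.min; do 3 case: ifP; lra.
Qed.

Lemma gauge_subadd l x y z : 0 <= y -> 0 <= z -> x <= y + z ->
  gauge l x <= gauge l y + gauge l z.
Proof.
move=> y0 z0 xyz; apply: gaugeP => i.
have : 0 < 2 ^+ l * h i by rewrite mulr_gt0 ?exprn_gt0.
move: (2 ^+ l * h i) => v v0.
by rewrite /Num.min; do 3 case: ifP; lra.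
Qed.

Lemma gauge_le_linear l x : 0 <= x -> gauge l x <= r%:R * x.
Proof.
move=> x0; apply: ler_sum_const => i; rewrite ler_pdivrMr //.
have := h_ge1 i.+1; rewrite ge_min; nra.
Qed.

(** The last scale has cap and denominator 1, so its term alone is [Num.min x 1]. *)
Lemma gauge_half x : 1 / 2 <= x -> 1 / 2 <= gauge 0 x.
Proof.
move=> xh; have r1 : (r.-1 < r)%N by rewrite prednK.
rewrite /gauge (bigD1 (Ordinal r1)) //= expr0 mul1r.
rewrite (h_last (leqnn _)) (h_last (leqnSn _)) divr1.
rewrite -[leLHS]addr0; apply: lerD; first by rewrite le_min; apply/andP; split; lra.
apply: sumr_ge0 => i _; apply: divr_ge0; last exact: ltW.
by rewrite le_min mulr_ge0 ?exprn_ge0 ?(ltW (h_gt0 i)) // andbT; lra.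
Qed.

Definition imbalance p q : R := `|log2 p - log2 q|.

Definition node_pot p q : R := gauge 0 (imbalance p q).

Lemma imbalanceC p q : imbalance p q = imbalance q p.
Proof. exact: distrC. Qed.

Lemma node_potC p q : node_pot p q = node_pot q p.
Proof. by rewrite /node_pot imbalanceC. Qed.

Lemma node_pot_ge0 p q : 0 <= node_pot p q.
Proof. exact/gauge_ge0/normr_ge0. Qed.

(* What m levels of linking guarantee for a block of weight p in front of a
   rest of weight q. *)
Definition credit (m : nat) p q : R :=
  if (m < r)%N then (h m < imbalance p q)%R%:R else 2 ^+ (m - r).

Lemma credit_ge0 m p q : 0 <= credit m p q.
Proof. by rewrite /credit; case: ifP; rewrite ?ler0n ?exprn_ge0. Qed.

Lemma imbalanceE p q : 0 < q -> q <= p -> imbalance p q = log2 p - log2 q.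
Proof. by move=> q0 qp; rewrite /imbalance ger0_norm // subr_ge0 ler_log2. Qed.

(** Here the weight drops by a factor of at least 3/2, so [D] and [gauge 0 D] are at least 1/2. By
    subadditivity each new term exceeds what it is compared with by at most two copies of
    [gauge 0 D]; four more copies pay for the constant 2. *)
Lemma link_bad a b c : 0 < a -> 0 < b -> 0 < c -> c <= 2 * (a + b) ->
  node_pot a b + node_pot (a + b) c + 2 <=
  node_pot a (b + c) + node_pot b c + 8 * gauge 0 (log2 (a + b + c) - log2 c).
Proof.
move=> a0 b0 c0 bad; set D := log2 _ - _.
(* Squares are compared, since 3/2 exceeds the square root of 2. *)
have Dhalf : 1 / 2 <= D.
  have : log2 (c * c * 2) <= log2 ((a + b + c) * (a + b + c)).
    by apply: ler_log2; nra.
  rewrite !log2M ?log2_2 ?mulr_gt0 ?addr_gt0 // /D; lra.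
have gD := gauge_half Dhalf.
have le1 : node_pot (a + b) c <= gauge 0 D + gauge 0 D.
  apply: gauge_subadd; [lra|lra|].
  have [le_c|lt_c] := leP c (a + b).
    rewrite imbalanceE //.
    have : log2 (a + b) <= log2 (a + b + c) by apply: ler_log2; lra.
    rewrite -/D /D in Dhalf *; lra.
  rewrite imbalanceC imbalanceE; [|lra|lra].
  have : log2 c <= log2 2 + log2 (a + b) by apply: ler_log2M => //; lra.
  rewrite log2_2; lra.
have le2 : node_pot a b <= node_pot a (b + c) + (node_pot b c + (gauge 0 D + gauge 0 D)).
  have -> : node_pot a b = gauge 0 (imbalance a b) by [].
  set X := node_pot a (b + c).
  have S1 : gauge 0 (imbalance b c + (D + D)) <= node_pot b c + gauge 0 (D + D).
    by apply: gauge_subadd; rewrite ?normr_ge0 //; lra.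
  have S2 : gauge 0 (D + D) <= gauge 0 D + gauge 0 D.
    by apply: gauge_subadd; lra.
  suff : gauge 0 (imbalance a b) <= X + gauge 0 (imbalance b c + (D + D)) by lra.
  apply: gauge_subadd; rewrite ?normr_ge0 //.
    by have := normr_ge0 (log2 b - log2 c); rewrite /imbalance; lra.
  have T : imbalance a b <= imbalance a (b + c) + imbalance (b + c) b.
    exact: ler_distD.
  suff : imbalance (b + c) b <= imbalance b c + 1 by lra.
  rewrite imbalanceE; [|lra|lra].
  have [le_c|lt_c] := leP c b.
    have : log2 (b + c) <= log2 2 + log2 b by apply: ler_log2M => //; lra.
    have := normr_ge0 (log2 b - log2 c); rewrite /imbalance log2_2; lra.
  have : log2 (b + c) <= log2 2 + log2 c by apply: ler_log2M => //; lra.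
  rewrite (imbalanceC b) imbalanceE; [|lra|lra].
  by rewrite log2_2; lra.
lra.
Qed.

(* A rest outweighing a and b makes both new imbalances at most the old ones;
   while the old ones are below the cap h m, the m-th term of the potential is
   linear and drops by at least the new imbalance. *)
Lemma link_good a b c : 0 < a -> 0 < b -> 0 < c -> a + b <= c ->
  node_pot a b + node_pot (a + b) c <= node_pot a (b + c) + node_pot b c /\
  (forall m, (m < r)%N ->
     imbalance a (b + c) <= h m -> imbalance b c <= h m ->
     node_pot a b + node_pot (a + b) c + imbalance (a + b) c / h m.+1 <=
     node_pot a (b + c) + node_pot b c).
Proof.
move=> a0 b0 c0 good.
rewrite /node_pot (imbalanceC a (b + c)) (imbalanceC b c) (imbalanceC (a + b)).
rewrite (imbalanceE (p := b + c)) ?(imbalanceE (p := c)); [|lra..].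
set A := log2 a; set B := log2 b; set C := log2 c.
set AB := log2 (a + b); set BC := log2 (b + c).
have ltA : A <= AB by apply: ler_log2; lra.
have ltB : B <= AB by apply: ler_log2; lra.
have ltC : AB <= C by apply: ler_log2; lra.
have ltBC : C <= BC by apply: ler_log2; lra.
rewrite /imbalance -/A -/B.
have capped i : Num.min `|A - B| (h i) + Num.min (C - AB) (h i) <=
    Num.min (BC - A) (h i) + Num.min (C - B) (h i).
  have min_le x y : x <= y -> Num.min x (h i) <= Num.min y (h i).
    by move=> xy; rewrite le_min !ge_min xy lexx orbT.
  (* Which old imbalance dominates which new one depends on the heavier of [a] and [b]. *)
  have [leAB|ltBA] := lerP A B; last rewrite [leRHS]addrC.
    by apply: lerD; apply: min_le; lra.
  by apply: lerD; apply: min_le; lra.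
split.
  rewrite /gauge -!big_split /=; apply: ler_sum => i _.
  by rewrite -!mulrDl ler_pM2r ?invr_gt0 // expr0 mul1r.
move=> m ltmr le1 le2.
rewrite /gauge -!big_split /= (bigD1 (Ordinal ltmr)) //=.
rewrite [leRHS](bigD1 (Ordinal ltmr)) //= [leLHS]addrAC.
apply: lerD; last first.
  apply: ler_sum => i _.
  by rewrite -!mulrDl ler_pM2r ?invr_gt0 // expr0 mul1r.
rewrite -!mulrDl ler_pM2r ?invr_gt0 // expr0 mul1r (min_l le1) (min_l le2).
have min_le x : Num.min x (h m) <= x by rewrite ge_min lexx.
have := min_le `|A - B|; have := min_le (C - AB).
by have [leAB|ltBA] := lerP A B; lra.
Qed.

(** From level [r] on, two credits add up to the next one. Below [r] the new credit is at most 1. It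
    is paid by the 2 of [link_bad], by an old credit, or, when both old imbalances are at most
    [h m], by the drop in [link_good], which is at least 1 as soon as the new imbalance exceeds
    [h m.+1]. *)
Lemma link_credit m a b c : 0 < a -> 0 < b -> 0 < c ->
  node_pot a b + node_pot (a + b) c + credit m.+1 (a + b) c <=
  node_pot a (b + c) + node_pot b c + credit m a (b + c) + credit m b c
    + 8 * gauge 0 (log2 (a + b + c) - log2 c).
Proof.
move=> a0 b0 c0.
have D0 : 0 <= log2 (a + b + c) - log2 c by rewrite subr_ge0 ler_log2 //; lra.
have gD := gauge_ge0 0 D0.
have Ca := credit_ge0 m a (b + c); have Cb := credit_ge0 m b c.
have [ltmr|lerm] := ltnP m r; last first.
  have plain : node_pot a b + node_pot (a + b) c <= node_pot a (b + c) +
      node_pot b c + 8 * gauge 0 (log2 (a + b + c) - log2 c).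
    have [bad|good] := leP c (2 * (a + b)); first by have := link_bad a0 b0 c0 bad; lra.
    have [|+ _] := @link_good a b c a0 b0 c0; first by lra.
    by lra.
  rewrite /credit !ltnNge lerm (leqW lerm) /= subSn // exprS; lra.
have C1 : credit m.+1 (a + b) c <= 1.
  rewrite /credit; case: ltnP => [_|lerm]; first by case: (_ < _).
  by have -> : (m.+1 = r)%N; [lia | rewrite subnn].
have [bad|good] := leP c (2 * (a + b)).
  by have := link_bad a0 b0 c0 bad; lra.
have [|plain gain] := @link_good a b c a0 b0 c0; first by lra.
have lt1 : 1 < imbalance b c.
  rewrite imbalanceC imbalanceE; [|lra|lra].
  have : log2 (2 * b) < log2 c by apply: ltr_log2; lra.
  by rewrite log2M // log2_2; lra.
rewrite {2 3}/credit ltmr.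
have [lta|lea] := ltP (h m) (imbalance a (b + c)).
  by have := ler0n R (h m < imbalance b c)%R; rewrite /=; lra.
have [ltb|leb] := ltP (h m) (imbalance b c); first by rewrite /=; lra.
have {}gain := gain _ ltmr lea leb.
(* If [m.+1 = r], then [h m = 1], and the imbalance of [b] and [c], exceeding 1, cannot be below the
   cap. *)
rewrite /credit; case: ltnP => [_|lerm]; last first.
  by move: leb; rewrite h_last ?leNgt ?lt1 // -ltnS prednK.
have := normr_ge0 (log2 (a + b) - log2 c); rewrite -/(imbalance _ _) => n0.
case: ltP => [lt|_] /=.
  have : 1 <= imbalance (a + b) c / h m.+1 by rewrite ler_pdivlMr // mul1r ltW.
  by lra.
by lra.
Qed.

(** Bounds the charges [8 * gauge 0] of all links in a tree of height [k]: the at most 2^l links at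
    depth [l] have drops of sum at most [D], so together they cost at most [8 * gauge l D]. *)
Definition debt (k : nat) D : R := 8 * \sum_(l < k) gauge l D.

Lemma debt_ge0 k D : 0 <= D -> 0 <= debt k D.
Proof. by move=> D0; rewrite mulr_ge0 // sumr_ge0 // => l _; exact: gauge_ge0. Qed.

Lemma ler_debt k D D' : D <= D' -> debt k D <= debt k D'.
Proof. by move=> le; rewrite ler_pM2l // ler_sum // => l _; exact: ler_gauge. Qed.

Lemma debt_split k D1 D2 : 0 <= D1 -> 0 <= D2 ->
  8 * gauge 0 (D1 + D2) + debt k D1 + debt k D2 <= debt k.+1 (D1 + D2).
Proof.
move=> D10 D20; rewrite /debt big_ord_recl /= -addrA -!mulrDr ler_pM2l //.
rewrite lerD2l -big_split; apply: ler_sum => l _; exact: gauge_split.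
Qed.

End Gauge.

(** * Weights of trees and of sequences of hanging trees *)

Section Weights.
Variables (R : realType) (K : Type).
Implicit Types (t u B : bst K) (ts : seq (bst K)).

(* The number of leaves of t. *)
Definition wt t : R := (size_bst t).+1%:R.

Definition wts ts : R := \sum_(u <- ts) wt u.

Lemma size_bst_node (tl tr : bst K) k :
  size_bst (Node tl k tr) = (size_bst tl + size_bst tr).+1.
Proof. by rewrite /size_bst /= size_cat /= addnS. Qed.

Lemma wt_ge1 t : 1 <= wt t.
Proof. by rewrite /wt ler1n. Qed.

Lemma wt_node (tl tr : bst K) k : wt (Node tl k tr) = wt tl + wt tr.
Proof. by rewrite /wt size_bst_node -natrD addSn addnS. Qed.

Lemma wts_ge0 ts : 0 <= wts ts.
Proof. by apply: sumr_ge0 => u _; rewrite ler0n. Qed.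

Lemma wts_ge1 ts : (0 < size ts)%N -> 1 <= wts ts.
Proof.
case: ts => // u us _; rewrite /wts big_cons -/(wts us).
by have := wt_ge1 u; have := wts_ge0 us; lra.
Qed.

Lemma wts_cat ts1 ts2 : wts (ts1 ++ ts2) = wts ts1 + wts ts2.
Proof. exact: big_cat. Qed.

Lemma wts_cons u ts : wts (u :: ts) = wt u + wts ts.
Proof. exact: big_cons. Qed.

Lemma wts_nil : wts [::] = 0.
Proof. exact: big_nil. Qed.

Lemma wts_rev ts : wts (rev ts) = wts ts.
Proof.
elim: ts => // u us IH.
by rewrite rev_cons -cats1 wts_cat !wts_cons wts_nil IH addr0 addrC.
Qed.

Lemma wt_graft B ts : size ts = (size_bst B).+1 -> wt (graft B ts) = wts ts.
Proof.
elim: B ts => [|Bl IHl k Br IHr] ts /=.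
  by case: ts => [|u []] //= _; rewrite /wts big_seq1.
rewrite size_bst_node wt_node => sz.
rewrite -[in RHS](cat_take_drop (size_bst Bl).+1 ts) wts_cat IHl ?IHr //.
  by rewrite size_drop; lia.
by rewrite size_take; case: ifP; lia.
Qed.

End Weights.

(** * Potential change when a path is rebuilt as a balanced tree *)

Section Restructuring.
Variables (R : realType) (r : nat) (h : nat -> R) (n : nat).
Hypothesis r_gt0 : (0 < r)%N.
Hypothesis h_ge1 : forall i, 1 <= h i.
Hypothesis h_last : forall i, (r.-1 <= i)%N -> h i = 1.
Hypothesis le_h0 : log2 n%:R <= h 0.

Variable K : Type.
Implicit Types (t u c B : bst K) (ts lam mu : seq (bst K)).

Local Notation gauge := (gauge r h).
Local Notation node_pot := (node_pot r h).
Local Notation credit := (credit r h).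
Local Notation debt := (debt r h).
Local Notation wt := (wt R).
Local Notation wts := (wts R).

Fixpoint pot t : R :=
  if t is Node tl _ tr then node_pot (wt tl) (wt tr) + pot tl + pot tr else 0.

(* The potential of a path turning always to the same side, from whose nodes
   the trees ts hang off, in front of a tree of weight C. *)
Fixpoint spine ts (C : R) : R :=
  if ts is u :: us then node_pot (wt u) (wts us + C) + pot u + spine us C else 0.

Fixpoint full m B : bool :=
  if m is m'.+1 then
    if B is Node Bl _ Br then full m' Bl && full m' Br else false
  else true.

Lemma spine_cat ts1 ts2 C :
  spine (ts1 ++ ts2) C = spine ts1 (wts ts2 + C) + spine ts2 C.
Proof.
elim: ts1 => [|u us IH] /=; first by rewrite add0r.
by rewrite IH wts_cat !addrA.
Qed.

Lemma fullP m Bl k Br : full m (Node Bl k Br) -> full m.-1 Bl /\ full m.-1 Br.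
Proof. by case: m => [|m] //= /andP. Qed.

Lemma imbalance_le_h0 p q : 1 <= p -> 1 <= q -> p + q <= n.+1%:R ->
  imbalance p q <= h 0.
Proof.
move=> p1 q1; rewrite -natr1 => le_n.
have : log2 p <= log2 n%:R by apply: ler_log2; lra.
have : log2 q <= log2 n%:R by apply: ler_log2; lra.
have := log2_ge0 p1; have := log2_ge0 q1; have := le_h0.
by rewrite /imbalance ler_norml => *; apply/andP; split; lra.
Qed.

Lemma node_pot_le p q : 1 <= p -> 1 <= q -> p + q <= n.+1%:R ->
  node_pot p q <= gauge 0 (h 0).
Proof. by move=> *; apply: ler_gauge => //; exact: imbalance_le_h0. Qed.

(** The inductive step of [spine_graft], with potentials abstracted to reals. At [m = 0] the level
    cannot decrease further, so the credit has to vanish there. *)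
Lemma block_step m k (a b C pa pb sa sb : R) : 0 < a -> 0 < b -> 0 < C ->
  (m = 0%N -> credit m (a + b) C <= 0) ->
  pa + node_pot a (b + C) + credit m.-1 a (b + C) <=
    sa + debt k (log2 (a + (b + C)) - log2 (b + C)) ->
  pb + node_pot b C + credit m.-1 b C <= sb + debt k (log2 (b + C) - log2 C) ->
  node_pot a b + pa + pb + node_pot (a + b) C + credit m (a + b) C <=
    sa + sb + debt k.+1 (log2 (a + b + C) - log2 C).
Proof.
move=> a0 b0 C0 cr0 IHa IHb.
have := debt_split r h_ge1 k (D1 := log2 (a + (b + C)) - log2 (b + C))
  (D2 := log2 (b + C) - log2 C).
rewrite !subr_ge0 !ler_log2; [|lra..].
move=> /(_ isT isT); rewrite addrA subrK addrA => split.
have := link_credit r_gt0 h_ge1 h_last m.-1 a0 b0 C0.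
have := credit_ge0 r h 1 (a + b) C.
rewrite addrA in IHa.
case: m cr0 IHa IHb => [/(_ erefl)|m _] /=; lra.
Qed.

(** Every node of [B] links the blocks built by its two subtrees; [s] tells which of them comes
    first on the path. The links are charged to [debt], and the [m] full levels raise the credit
    step by step. *)
Lemma spine_graft (s : bool) B ts (C : R) m k :
  size ts = (size_bst B).+1 -> (height B <= k)%N -> full m B ->
  1 <= C -> wts ts + C <= n.+1%:R ->
  pot (graft B ts) + node_pot (wts ts) C + credit m (wts ts) C <=
  spine (if s then rev ts else ts) C + debt k (log2 (wts ts + C) - log2 C).
Proof.
(* No imbalance exceeds [h 0], so a single tree starts without credit. *)
have cr0 p q : 1 <= p -> 1 <= q -> p + q <= n.+1%:R -> credit 0 p q = 0.
  by move=> p1 q1 le_n; rewrite /credit r_gt0 ltNge imbalance_le_h0.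
elim: B ts C m k => [|Bl IHl x Br IHr] ts C m k.
  case: ts => [|u []] //= _ _; case: m => // _ C1.
  rewrite /wts big_seq1 => le_n; rewrite cr0 ?wt_ge1 //.
  have -> : (if s then rev [:: u] else [:: u]) = [:: u] by case: s.
  have u1 := wt_ge1 R u.
  have D0 : 0 <= log2 (wt u + C) - log2 C by rewrite subr_ge0 ler_log2 //; lra.
  have := debt_ge0 r h_ge1 k D0.
  by rewrite /= wts_nil add0r; lra.
rewrite size_bst_node; case: k => [|k] //= sz; rewrite ltnS geq_max => /andP[hl hr].
move=> /fullP [fl fr] C1.
have szl : size (take (size_bst Bl).+1 ts) = (size_bst Bl).+1.
  by rewrite size_take; case: ifP; lia.
have szr : size (drop (size_bst Bl).+1 ts) = (size_bst Br).+1.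
  by rewrite size_drop; lia.
rewrite !wt_graft //.
have -> : wts ts = wts (take (size_bst Bl).+1 ts) + wts (drop (size_bst Bl).+1 ts).
  by rewrite -wts_cat cat_take_drop.
rewrite -[in X in spine X](cat_take_drop (size_bst Bl).+1 ts) rev_cat.
move: (take _ ts) (drop _ ts) szl szr => tl tr szl szr le_n.
have l1 : 1 <= wts tl by rewrite wts_ge1 ?szl.
have r1 : 1 <= wts tr by rewrite wts_ge1 ?szr.
have m0 : m = 0%N -> credit m (wts tl + wts tr) C <= 0.
  by move=> ->; rewrite cr0 //; lra.
case: s IHl IHr => IHl IHr; rewrite spine_cat ?wts_rev.
  (* In the mirrored case the block of [Br] is in front. *)
  rewrite node_potC (addrC (wts tl)) in m0 *.
  rewrite [X in X + node_pot _ _]addrAC.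
  apply: block_step => //; try lra.
    by apply: IHr => //; lra.
  by apply: IHl => //; lra.
apply: block_step => //; try lra.
  by apply: IHl => //; lra.
by apply: IHr => //; lra.
Qed.

(** The telescoped sum of the drops along one half of a search path ending in [c]. *)
Definition depth_drop ts c : R := log2 (wts ts + wt c) - log2 (wt c).

Lemma depth_drop_ge0 ts c : 0 <= depth_drop ts c.
Proof.
rewrite subr_ge0 ler_log2 //; have := wt_ge1 R c; have := wts_ge0 R ts; lra.
Qed.

(** At most [k] nodes of [B] lie above the leaf that receives [c], each of potential at most
    [gauge 0 (h 0)]. The blocks beside them are one-sided, so [spine_graft] applies. Only the block
    beside the root, with [m.-1] full levels, is used for the gain. *)
Lemma spine_graft_focus B lam c mu m k :
  (size lam + size mu = size_bst B)%N -> (height B <= k)%N -> full m B ->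
  wts lam + wt c + wts mu <= n.+1%:R ->
  pot (graft B (lam ++ c :: mu)) + (if (r < m)%N then 2 ^+ (m.-1 - r) else 0) <=
  spine lam (wt c) + spine (rev mu) (wt c) + pot c
    + debt k (depth_drop lam c + depth_drop mu c) + k%:R * gauge 0 (h 0).
Proof.
have g0 : 0 <= gauge 0 (h 0) by apply: gauge_ge0 => //; exact: le_trans (h_ge1 0).
elim: B lam mu m k => [|Bl IHl x Br IHr] lam mu m k.
  case: lam mu => [|//] [|//] _ _; case: m => // _ _ /=.
  have := debt_ge0 r h_ge1 k (addr_ge0 (depth_drop_ge0 [::] c) (depth_drop_ge0 [::] c)).
  by have := mulr_ge0 (ler0n R k) g0; lra.
rewrite size_bst_node; case: k => [|k] //= sz; rewrite ltnS geq_max => /andP[hl hr].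
move=> /fullP [fl fr] le_n; have c1 := wt_ge1 R c.
have lam0 := wts_ge0 R lam; have mu0 := wts_ge0 R mu.
have gk : k.+1%:R * gauge 0 (h 0) = k%:R * gauge 0 (h 0) + gauge 0 (h 0).
  by rewrite -natr1 mulrDl mul1r.
have gain_le p q : (if (r < m)%N then 2 ^+ (m.-1 - r) else 0) <= credit m.-1 p q.
  case: ltnP => [ltrm|_]; last exact: credit_ge0.
  by rewrite /credit ifN //; lia.
move: (if _ then _ else _ : R) gain_le => gain gain_le.
(* The tree [c] has index [size lam], so it falls into [Br] exactly when [lam] fills all
   [(size_bst Bl).+1] leaves of [Bl]. *)
have [ltl|lel] := ltnP (size_bst Bl) (size lam).
  have szl : size (take (size_bst Bl).+1 lam) = (size_bst Bl).+1.
    by rewrite size_takel.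
  have szr : size (drop (size_bst Bl).+1 lam) = (size lam - (size_bst Bl).+1)%N.
    by rewrite size_drop.
  rewrite -(cat_take_drop (size_bst Bl).+1 lam) in le_n lam0 *.
  move: (take _ lam) (drop _ lam) szl szr le_n lam0 => lam1 lam2 szl szr.
  rewrite -catA take_size_cat // drop_size_cat // wts_cat => le_n lam0.
  have lam11 : 1 <= wts lam1 by rewrite wts_ge1 ?szl.
  have lam20 := wts_ge0 R lam2.
  have sz2 : size (lam2 ++ c :: mu) = (size_bst Br).+1.
    by rewrite size_cat /=; lia.
  rewrite !wt_graft // wts_cat wts_cons spine_cat.
  have := @spine_graft false Bl lam1 (wts lam2 + wt c) m.-1 k.
  move=> /(_ szl hl fl); set d1 := _ - log2 _; rewrite /= => IH1.
  have {}IH1 := IH1 ltac:(lra) ltac:(lra).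
  (* Level 0 asks for no further gain below the root. *)
  have := IHr lam2 mu 0%N k ltac:(lia) hr isT ltac:(lra).
  rewrite /= addr0; set d2 := _ + depth_drop _ _ => IH2.
  have d10 : 0 <= d1 by rewrite subr_ge0 ler_log2 //; lra.
  have d20 : 0 <= d2 by rewrite addr_ge0 ?depth_drop_ge0.
  have := debt_split r h_ge1 k d10 d20.
  have -> : d1 + d2 = depth_drop (lam1 ++ lam2) c + depth_drop mu c.
    by rewrite /d1 /d2 /depth_drop wts_cat !addrA; lra.
  have := gauge_ge0 r h_ge1 0 (addr_ge0 (depth_drop_ge0 (lam1 ++ lam2) c) (depth_drop_ge0 mu c)).
  have := node_pot_ge0 r h_ge1 (wts lam1) (wts lam2 + wt c).
  have := gain_le (wts lam1) (wts lam2 + wt c).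
  have := @node_pot_le (wts lam1) (wts lam2 + (wt c + wts mu)) lam11 ltac:(lra) ltac:(lra).
  by lra.
have szl : size (take (size_bst Bl - size lam) mu) = (size_bst Bl - size lam)%N.
  by rewrite size_takel //; lia.
have szr : size (drop (size_bst Bl - size lam) mu) = (size_bst Br).+1.
  by rewrite size_drop; lia.
rewrite -(cat_take_drop (size_bst Bl - size lam) mu) in le_n mu0 *.
move: (take _ mu) (drop _ mu) szl szr le_n mu0 => mu1 mu2 szl szr.
have sz1 : size (lam ++ c :: mu1) = (size_bst Bl).+1 by rewrite size_cat /=; lia.
rewrite -cat_cons catA take_size_cat // drop_size_cat // wts_cat => le_n mu0.
have mu21 : 1 <= wts mu2 by rewrite wts_ge1 ?szr.
have mu10 := wts_ge0 R mu1.
rewrite !wt_graft // wts_cat wts_cons rev_cat spine_cat wts_rev.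
have := @spine_graft true Br mu2 (wts mu1 + wt c) m.-1 k.
move=> /(_ szr hr fr); set d1 := _ - log2 _; rewrite /= => IH1.
have {}IH1 := IH1 ltac:(lra) ltac:(lra).
have := IHl lam mu1 0%N k ltac:(lia) hl isT ltac:(lra).
rewrite /= addr0; set d2 := _ + depth_drop _ _ => IH2.
have d10 : 0 <= d1 by rewrite subr_ge0 ler_log2 //; lra.
have d20 : 0 <= d2 by rewrite addr_ge0 ?depth_drop_ge0.
have := debt_split r h_ge1 k d10 d20.
have -> : d1 + d2 = depth_drop lam c + depth_drop (mu1 ++ mu2) c.
  by rewrite /d1 /d2 /depth_drop wts_cat (addrC (wts mu1) (wts mu2)) !addrA; lra.
have := gauge_ge0 r h_ge1 0 (addr_ge0 (depth_drop_ge0 lam c) (depth_drop_ge0 (mu1 ++ mu2) c)).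
have := node_pot_ge0 r h_ge1 (wts mu2) (wts mu1 + wt c).
have := gain_le (wts mu2) (wts mu1 + wt c).
have := @node_pot_le (wts lam + (wt c + wts mu1)) (wts mu2) ltac:(lra) mu21 ltac:(lra).
by lra.
Qed.

(** Needed when a path is split into its two halves, which lightens the rest below each node. If [q]
    still outweighs [a], the imbalance only falls; otherwise it is at most the logarithmic drop, and
    the gauge has slope at most [r]. *)
Lemma node_pot_shrink (a p q : R) : 0 < a -> 0 < q -> q <= p ->
  node_pot a q <= node_pot a p + r%:R * (log2 (a + q) - log2 q).
Proof.
move=> a0 q0 le_pq; have [le_aq|lt_qa] := leP a q.
  have D0 : 0 <= r%:R * (log2 (a + q) - log2 q).
    by rewrite mulr_ge0 // subr_ge0 ler_log2 //; lra.
  have : node_pot a q <= node_pot a p; last by lra.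
  apply: ler_gauge => //; rewrite !(imbalanceC a) !imbalanceE //; last lra.
  by rewrite lerD2r ler_log2.
have D1 : log2 a - log2 q <= log2 (a + q) - log2 q by rewrite lerD2r ler_log2 //; lra.
have D0 : 0 <= log2 a - log2 q by rewrite subr_ge0 ler_log2 //; lra.
have := node_pot_ge0 r h_ge1 a p.
have : node_pot a q <= r%:R * (log2 (a + q) - log2 q); last by lra.
apply: le_trans (ler_wpM2l (ler0n _ _) D1).
rewrite -[node_pot a q]/(gauge 0 (imbalance a q)) imbalanceE //; last lra.
exact: gauge_le_linear.
Qed.

Lemma pot_le t : wt t <= n.+1%:R -> pot t <= (size_bst t)%:R * gauge 0 (h 0).
Proof.
elim: t => [|tl IHl x tr IHr]; first by rewrite /size_bst /= mul0r.
rewrite wt_node size_bst_node => le_n.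
have -> : (size_bst tl + size_bst tr).+1%:R = (size_bst tl)%:R + (size_bst tr)%:R + 1 :> R.
  by rewrite -natr1 natrD.
have l1 := wt_ge1 R tl; have r1 := wt_ge1 R tr.
have := IHl ltac:(lra); have := IHr ltac:(lra); have := node_pot_le l1 r1 le_n.
rewrite /=; lra.
Qed.

Lemma pot_ge0 t : 0 <= pot t.
Proof.
by elim: t => //= tl IHl _ tr IHr; rewrite !addr_ge0 //; exact: node_pot_ge0.
Qed.

End Restructuring.

(** * Splitting a search path into its left and right turns *)

Section SearchPath.
Variables (R : realType) (r : nat) (h : nat -> R).
Hypothesis h_ge1 : forall i, 1 <= h i.
Variables (d : Order.disp_t) (K : orderType d).
Implicit Types (t : bst K) (x : K).

(** At each node only the trees hanging on its own side and [c] remain in the rest, which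
    [node_pot_shrink] accounts for; the drops telescope. As [mu] lists its trees from the bottom up,
    its spine is taken of [rev mu]. *)
Lemma search_path_split x t : exists lam c mu,
  [/\ hanging_subtrees x t = lam ++ c :: mu,
      size (search_path x t) = (size lam + size mu)%N,
      wts R lam + wt R c + wts R mu = wt R t
    & spine r h lam (wt R c) + spine r h (rev mu) (wt R c) + pot r h c <=
      pot r h t + r%:R * (depth_drop R lam c + depth_drop R mu c)].
Proof.
elim: t => [|tl IHl k tr IHr] /=.
  exists [::], Leaf, [::]; split=> //=; first by rewrite wts_nil add0r addr0.
  rewrite !add0r mulr_ge0 // addr_ge0 // depth_drop_ge0 //.
have [l1 r1] := (wt_ge1 R tl, wt_ge1 R tr).
case: ifP => _; [|case: ifP => _].
(* The node of [x] counts as a turn to the left, ending in its left subtree. *)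
- exists [::], tl, [:: tr]; split=> //=.
    by rewrite wts_cons !wts_nil wt_node add0r addr0.
  have := mulr_ge0 (ler0n R r) (addr_ge0 (depth_drop_ge0 R [::] tl) (depth_drop_ge0 R [:: tr] tl)).
  by rewrite wts_nil !add0r node_potC; lra.
- have [lam [c [mu [-> -> wE le_pot]]]] := IHl.
  exists lam, c, (rcons mu tr); split.
  + by rewrite rcons_cat.
  + by rewrite size_rcons addnS.
  + by rewrite -cats1 wts_cat wts_cons wts_nil wt_node -wE; ring.
  have c1 := wt_ge1 R c; have lam0 := wts_ge0 R lam; have mu0 := wts_ge0 R mu.
  have := @node_pot_shrink R r h h_ge1 (wt R tr) (wt R tl) (wts R mu + wt R c)
    ltac:(lra) ltac:(lra) ltac:(lra).
  rewrite rev_rcons /= wts_rev (node_potC r h (wt R tl)).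
  have -> : depth_drop R (rcons mu tr) c =
      log2 (wt R tr + (wts R mu + wt R c)) - log2 (wts R mu + wt R c) + depth_drop R mu c.
    rewrite /depth_drop subrKA -cats1 wts_cat wts_cons wts_nil addr0.
    by rewrite (addrC (wts R mu) (wt R tr)) -addrA.
  by rewrite !mulrDr in le_pot *; lra.
have [lam [c [mu [-> -> wE le_pot]]]] := IHr.
exists (tl :: lam), c, mu; split=> //.
  by rewrite wts_cons wt_node -wE; ring.
have c1 := wt_ge1 R c; have lam0 := wts_ge0 R lam; have mu0 := wts_ge0 R mu.
have := @node_pot_shrink R r h h_ge1 (wt R tl) (wt R tr) (wts R lam + wt R c)
  ltac:(lra) ltac:(lra) ltac:(lra).
have -> : depth_drop R (tl :: lam) c =
    log2 (wt R tl + (wts R lam + wt R c)) - log2 (wts R lam + wt R c) + depth_drop R lam c.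
  by rewrite /depth_drop subrKA wts_cons addrA.
by rewrite /= !mulrDr in le_pot *; lra.
Qed.

End SearchPath.

(** * Size and full levels of complete trees *)

Section CompleteTrees.
Variable K : Type.
Implicit Types t : bst K.

Lemma size_lt_expn_height t : (size_bst t < 2 ^ height t)%N.
Proof.
elim: t => [|tl IHl k tr IHr] //; rewrite size_bst_node /= expnS mul2n -addnn.
have le_l := leq_pexp2l (isT : (0 < 2)%N) (leq_maxl (height tl) (height tr)).
have le_r := leq_pexp2l (isT : (0 < 2)%N) (leq_maxr (height tl) (height tr)).
rewrite -addnS -addSn.
by apply: leq_add; [exact: leq_trans IHl le_l | exact: leq_trans IHr le_r].
Qed.

Lemma full_size m t : full m t -> (2 ^ m <= (size_bst t).+1)%N.
Proof.
elim: m t => [|m IH] [|tl k tr] //= /andP[/IH ml /IH mr].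
by rewrite size_bst_node expnS mul2n -addnn -addnS -addSn leq_add.
Qed.

Lemma level_size_le t i : (level_size t i <= 2 ^ i)%N.
Proof.
elim: t i => [|tl IHl k tr IHr] [|i] //=; rewrite ?expn_gt0 //.
by rewrite expnS mul2n -addnn leq_add.
Qed.

(** Neither subtree can exceed its share of a level, so a filled level is filled in both. *)
Lemma level_size_full t i : level_size t i = (2 ^ i)%N -> full i.+1 t.
Proof.
elim: t i => [|tl IHl k tr IHr] [|i] //=.
  by move/eqP; rewrite eq_sym expn_eq0.
have := level_size_le tl i; have := level_size_le tr i.
by rewrite expnS => ler lel sz; apply/andP; split; [apply: IHl|apply: IHr]; lia.
Qed.

Lemma complete_full t : complete_bst t -> full (height t).-1 t.
Proof.
case ht: (height t) => [|[|k]] // cpl.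
by apply: level_size_full; apply: cpl; rewrite ht.
Qed.

End CompleteTrees.

(** * Numerical bounds on the gain and the debt *)

Lemma le_gain (R : realType) (r k : nat) :
  2 ^+ k / 2 ^+ r / 4 - 1 <= (if (r < k.-1)%N then 2 ^+ (k.-1.-1 - r) else 0) :> R.
Proof.
have e0 : 0 < 2 ^+ r :> R by rewrite exprn_gt0.
case: ltnP => [lt_rk|le_kr].
  have [j ->] : exists j, k = (j + r).+2 by exists (k.-1.-1 - r)%N; lia.
  rewrite /= addnK 2!exprS exprD !mulrA mulfK ?gt_eqF //.
  by lra.
have : 2 ^+ k / 2 ^+ r <= 2 :> R; last by lra.
by rewrite ler_pdivrMr // -exprS -!natrX ler_nat leq_pexp2l //; lia.
Qed.

(** The terms grow geometrically until they reach [x], at about [l = log2 (x / y)], and are constant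
    afterwards. *)
Lemma sum_capped_powers (R : realType) (x y : R) (k : nat) : 0 < x -> 0 < y ->
  \sum_(l < k) Num.min x (2 ^+ l * y) <=
  x * (2 + Num.max 0 (k%:R - log2 (x / y))).
Proof.
move=> x0 y0.
(* The first bound carries the induction through the geometric phase. *)
suff : \sum_(l < k) Num.min x (2 ^+ l * y) <= 2 ^+ k * y /\
  \sum_(l < k) Num.min x (2 ^+ l * y) <=
  x * (2 + Num.max 0 (k%:R - log2 (x / y))) by case.
elim: k => [|k [IH1 IH2]].
  rewrite big_ord0 expr0 mul1r; split; first exact: ltW.
  by rewrite mulr_ge0 // ?(ltW x0) // addr_ge0 // le_max lexx.
rewrite big_ord_recr /= exprS; have [le_x|lt_x] := lerP x (2 ^+ k * y).
  split; first by lra.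
  have le_k : log2 (x / y) <= k%:R.
    by rewrite -log2X ler_log2 ?divr_gt0 // ler_pdivrMr.
  rewrite -natr1; rewrite max_r in IH2; last by lra.
  by rewrite max_r; lra.
split; first by lra.
have : 0 <= x * Num.max 0 (k.+1%:R - log2 (x / y)).
  by rewrite mulr_ge0 ?(ltW x0) // le_max lexx.
rewrite mulrDr; lra.
Qed.

(** Scale [i] is uncapped for [log2 (h i)] fewer levels than a scale of cap 1. This excess is at
    most [h i.+1], and the denominator turns it into a constant. *)
Lemma sum_gauge (R : realType) (r : nat) (h : nat -> R) (k : nat) (x : R) :
  (forall i, 1 <= h i) -> (forall i, log2 (h i) <= h i.+1) -> 1 <= x ->
  \sum_(l < k) gauge r h l x <=
  r%:R * (x * (3 + Num.max 0 (k%:R - log2 x))).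
Proof.
move=> h_ge1 log_h x1; rewrite exchange_big; apply: ler_sum_const => i.
have hi := h_ge1 i; have hi1 := h_ge1 i.+1; have log_hi := log_h i.
rewrite -mulr_suml ler_pdivrMr; last by lra.
apply: (le_trans (sum_capped_powers _ _ _)); [lra|lra|].
rewrite log2M ?invr_gt0 ?log2V; [|lra..].
rewrite -mulrA ler_pM2l; last by lra.
set M := Num.max 0 (k%:R - log2 x).
have M0 : 0 <= M by rewrite le_max lexx.
have leM : k%:R - log2 x <= M by rewrite le_max lexx orbT.
have : Num.max 0 (k%:R - (log2 x - log2 (h i))) <= M + h i.+1.
  by rewrite ge_max; apply/andP; split; lra.
nra.
Qed.

(** * Amortized cost of one access and of a run *)

Section AccessCost.
Variables (R : realType) (r : nat) (h : nat -> R) (n : nat).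
Hypothesis n_ge2 : (2 <= n)%N.
Hypothesis r_gt0 : (0 < r)%N.
Hypothesis h_ge1 : forall i, 1 <= h i.
Hypothesis h_last : forall i, (r.-1 <= i)%N -> h i = 1.
Hypothesis log_h : forall i, log2 (h i) <= h i.+1.
Hypothesis h0E : h 0 = log2 n%:R.

Variables (d : Order.disp_t) (K : orderType d).
Implicit Types (t : bst K) (x : K).

Lemma pot_le_initial t : size_bst t = n ->
  pot r h t <= n%:R * (r%:R * log2 n%:R).
Proof.
move=> szt; have le0 : log2 n%:R <= h 0 by rewrite h0E.
apply: (le_trans (pot_le r h_ge1 le0 _)); first by rewrite /wt szt.
rewrite szt ler_wpM2l ?ler0n // -h0E.
apply: gauge_le_linear; first exact: h_ge1.
exact: le_trans (h_ge1 0).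
Qed.

Lemma access_size x t t' : path_balance_access x t t' -> size_bst t' = size_bst t.
Proof.
case=> _ [b [_ _ /perm_size szb ->]].
have [lam [c [mu [hE pE wE _]]]] := search_path_split r h_ge1 x t.
apply: succn_inj; apply/eqP; rewrite -(eqr_nat R) -/(wt R _) -/(wt R t).
rewrite wt_graft ?hE; last by rewrite size_cat /= addnS /size_bst szb pE.
by rewrite wts_cat wts_cons addrA wE.
Qed.

Lemma depth_drop_le (ts : seq (bst K)) c : wts R ts + wt R c <= n.+1%:R ->
  depth_drop R ts c <= 2 * h 0.
Proof.
move=> le_n; have c1 := wt_ge1 R c; have ts0 := wts_ge0 R ts.
have : log2 (wts R ts + wt R c) <= log2 2 + log2 n%:R.
  apply: ler_log2M; rewrite ?ltr0n //; [lia|lra|].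
  by apply: le_trans le_n _; rewrite -natrM ler_nat; lia.
have := log2_ge0 c1; have := h_ge1 0.
rewrite /depth_drop log2_2 h0E; lra.
Qed.

(* log2 Z <= 2 Z bounds the excess of k over log2 (4 L) by 2 r + 9 + 2 Z. *)
Lemma restructuring_le k (D : R) : D <= 4 * h 0 ->
  debt r h k D + k%:R * gauge r h 0 (h 0) <=
  36 * (r%:R * h 0) * (12 + 2 * r%:R) + 9 / 256 * (2 ^+ k / 2 ^+ r).
Proof.
have L1 := h_ge1 0; set L := h 0 in L1 * => DL.
have rR : 1 <= r%:R :> R by rewrite ler1n r_gt0.
have e0 : 0 < 2 ^+ r :> R by rewrite exprn_gt0.
have re : r%:R <= 2 ^+ r :> R by rewrite -natrX ler_nat ltnW // ltn_expl.
set S := \sum_(l < k) gauge r h l (4 * L).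
have debtS : debt r h k D + k%:R * gauge r h 0 L <= 9 * S.
  have debt_le : debt r h k D <= 8 * S by apply: ler_debt => //; exact: h_ge1.
  suff : k%:R * gauge r h 0 L <= S by lra.
  have -> : k%:R * gauge r h 0 L = \sum_(l < k) gauge r h 0 L.
    by rewrite sumr_const card_ord mulr_natl.
  apply: ler_sum => l _; apply: ler_sum => i _; have hi := h_ge1 i.
  rewrite ler_pM2r ?invr_gt0; last exact: lt_le_trans (h_ge1 _).
  have : 1 <= 2 ^+ l :> R by rewrite exprn_ege1 // ler1n.
  rewrite expr0 mul1r le_min !ge_min => l1.
  by apply/andP; split; apply/orP; [left; lra|right; nra].
(* One factor [2 ^+ r] matches the gain, the other absorbs the factor [r], and [2 ^+ 9] keeps the
   resulting term a small fraction of the gain. *)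
set Z : R := 2 ^+ k / (4 * L * (2 ^+ r * 2 ^+ r * 2 ^+ 9)).
have den0 : 0 < 4 * L * (2 ^+ r * 2 ^+ r * 2 ^+ 9).
  by rewrite !mulr_gt0 ?exprn_gt0 //; lra.
have Z0 : 0 < Z by rewrite divr_gt0 ?exprn_gt0.
have S_le : S <= r%:R * (4 * L * (12 + 2 * r%:R + 2 * Z)).
  apply: le_trans (sum_gauge r k h_ge1 log_h _) _; first by lra.
  rewrite ler_pM2l; last by lra.
  rewrite ler_pM2l; last by lra.
  have : Num.max 0 (k%:R - log2 (4 * L)) <= 2 * r%:R + 9 + 2 * Z; last by lra.
  rewrite ge_max; apply/andP; split; first by lra.
  have logZ : log2 Z = k%:R - (log2 (4 * L) + (r%:R + r%:R + 9)).
    rewrite /Z [LHS]log2M ?invr_gt0 ?exprn_gt0 // log2V // log2X; congr (_ - _).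
    rewrite [LHS]log2M ?mulr_gt0 ?exprn_gt0 //; last by lra.
    congr (_ + _).
    by rewrite 2?log2M ?mulr_gt0 ?exprn_gt0 // !log2X.
  by have := log2_le_double Z0; lra.
have ZE : r%:R * L * Z * 2048 <= 2 ^+ k / 2 ^+ r.
  have -> : r%:R * L * Z * 2048 = r%:R / 2 ^+ r * (2 ^+ k / 2 ^+ r).
    by rewrite /Z; field; rewrite !gt_eqF //; lra.
  rewrite ler_piMl ?divr_ge0 ?exprn_ge0 // ler_pdivrMr // mul1r //.
have -> : 36 * (r%:R * L) * (12 + 2 * r%:R) =
    9 * (r%:R * (4 * L * (12 + 2 * r%:R + 2 * Z))) - 72 * (r%:R * L * Z) by ring.
lra.
Qed.

Lemma access_cost x t t' : size_bst t = n -> path_balance_access x t t' ->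
  (size (search_path x t))%:R <=
  8 * 2 ^+ r * (pot r h t - pot r h t' + 509 * (r%:R ^+ 2 * log2 n%:R)).
Proof.
move=> szt [_ [b [cpl _ /perm_size szb ->]]].
have [lam [c [mu [hE pE wE le_pot]]]] := search_path_split r h_ge1 x t.
set p := size (search_path x t) in szb pE *; set k := height b.
have le_n : wts R lam + wt R c + wts R mu <= n.+1%:R by rewrite wE /wt szt.
have le0 : log2 n%:R <= h 0 by rewrite h0E.
have := spine_graft_focus r_gt0 h_ge1 h_last le0 (B := b)
  (lam := lam) (c := c) (mu := mu) (m := k.-1) (k := k).
rewrite -hE /size_bst szb pE => /(_ erefl (leqnn _) (complete_full cpl) le_n).
move: le_pot.
set t1 := graft _ _; set gain := if _ then _ else _.
set D := depth_drop R lam c + _ => le_pot le_graft.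
have L1 := h_ge1 0; set L := h 0 in L1.
have DL : D <= 4 * L.
  have mu0 := wts_ge0 R mu; have lam0 := wts_ge0 R lam.
  have := @depth_drop_le lam c ltac:(lra); have := @depth_drop_le mu c ltac:(lra).
  by rewrite /D -/L; lra.
have D0 : 0 <= D by rewrite addr_ge0 ?depth_drop_ge0.
have rR : 1 <= r%:R :> R by rewrite ler1n r_gt0.
have e0 : 0 < 2 ^+ r :> R by rewrite exprn_gt0.
have restr := restructuring_le k DL; rewrite -/L in restr.
have pk : p.+1%:R <= 2 ^+ k :> R.
  by rewrite -natrX ler_nat -szb; exact: size_lt_expn_height.
have kp : 2 ^+ k <= 2 * p.+1%:R :> R.
  have := full_size (complete_full cpl); rewrite -/k /size_bst szb => le_k.
  rewrite -natrX -natrM ler_nat; case: (k) le_k => [|k'] /=; first by rewrite expn0 muln_gt0.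
  by rewrite expnS leq_mul2l.
have gain_ge : p.+1%:R / 2 ^+ r / 4 - 1 <= gain.
  have le_kr : p.+1%:R / 2 ^+ r <= 2 ^+ k / 2 ^+ r :> R.
    by rewrite ler_pM2r ?invr_gt0.
  by have := le_gain R r k; rewrite -/gain; lra.
(* The error term is at most 9/128 of the left side, and 1/4 - 9/128 is at least 1/8, whence the
   factor 8. The constant 509 is 432 + 72 from the restructuring, 4 from splitting the path and 1
   from [gain_ge]. *)
have wle : p.+1%:R / 2 ^+ r <= 8 * (pot r h t - pot r h t1 + 509 * (r%:R ^+ 2 * L)).
  have rL : r%:R * L <= r%:R ^+ 2 * L by rewrite ler_pM2r; [nra|lra].
  have : 1 <= r%:R ^+ 2 * L by nra.
  have : r%:R * D <= 4 * (r%:R * L) by nra.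
  have : 2 ^+ k / 2 ^+ r <= 2 * (p.+1%:R / 2 ^+ r) :> R.
    by rewrite mulrA ler_pM2r ?invr_gt0.
  have : 0 <= p.+1%:R / 2 ^+ r :> R by rewrite divr_ge0 ?ler0n ?exprn_ge0.
  have rrE : 36 * (r%:R * L) * (12 + 2 * r%:R) = 432 * (r%:R * L) + 72 * (r%:R ^+ 2 * L).
    by ring.
  rewrite rrE in restr; rewrite -/L in le_graft.
  lra.
rewrite ler_pdivrMr // mulrAC /L h0E in wle.
by apply: le_trans wle; rewrite ler_nat -pE.
Qed.

(** The potential differences telescope, and the final potential is nonnegative. *)
Lemma run_cost t xs t' c : size_bst t = n -> path_balance_run t xs t' c ->
  c%:R <= 8 * 2 ^+ r * (pot r h t + (size xs)%:R * (509 * (r%:R ^+ 2 * log2 n%:R))).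
Proof.
move=> szt run; elim: run szt => {t xs t' c} [t|t x t' xs t'' c acc _ IH] szt.
  rewrite mul0r addr0 mulr_ge0 ?mulr_ge0 ?exprn_ge0 //.
  exact/pot_ge0/h_ge1.
have := access_cost szt acc; have := IH (etrans (access_size acc) szt).
by rewrite natrD /= -natr1; lra.
Qed.

Lemma run_cost_le t xs t' c : size_bst t = n -> path_balance_run t xs t' c ->
  c%:R <= 4072 * (log2 (n%:R : R) * r%:R ^+ 2 * 2 ^+ r) * (size xs + n)%:R.
Proof.
move=> szt run; apply: le_trans (run_cost szt run) _.
have := pot_le_initial szt; have := h_ge1 0; rewrite h0E.
set L := log2 _ => L1 pot_t.
have rL : r%:R * L <= r%:R ^+ 2 * L.
  rewrite ler_wpM2r //; first by lra.
  by rewrite -natrX ler_nat -mulnn leq_pmulr.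
(* The initial potential costs no more than [n] further accesses; 4072 is 8 * 509. *)
have pot_t' : pot r h t <= n%:R * (509 * (r%:R ^+ 2 * L)).
  apply: le_trans pot_t _; rewrite ler_wpM2l //.
  have : 0 <= r%:R ^+ 2 * L by rewrite mulr_ge0 ?exprn_ge0 //; lra.
  by lra.
have -> : 4072 * (L * r%:R ^+ 2 * 2 ^+ r) * (size xs + n)%:R =
    8 * 2 ^+ r * (n%:R * (509 * (r%:R ^+ 2 * L)) +
                  (size xs)%:R * (509 * (r%:R ^+ 2 * L))).
  by rewrite natrD; ring.
by rewrite ler_pM2l ?mulr_gt0 ?exprn_gt0 // lerD2r.
Qed.

End AccessCost.

(** * The scales given by the iterated logarithm *)

Section Scales.
Variables (R : realType) (n : nat).
Hypothesis n_ge2 : (2 <= n)%N.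

Definition scale (i : nat) : R := Num.max 1 (iter i.+1 (@log2 R) n%:R).

Local Notation r := (log_star (n%:R : R)).

Lemma iter_log_star : iter r (@log2 R) n%:R <= 1.
Proof. by rewrite /log_star; case: ex_minnP. Qed.

Lemma log_star_gt0 : (0 < r)%N.
Proof.
have := iter_log_star; case: r => //=.
by rewrite -[1]/(1%:R) ler_nat leqNgt n_ge2.
Qed.

Lemma scale_ge1 i : 1 <= scale i.
Proof. by rewrite le_max lexx. Qed.

Lemma scale_last i : (r.-1 <= i)%N -> scale i = 1.
Proof.
move=> le_i; apply: max_l.
(* Once an iterate is at most 1, all later ones are at most 0; [log2_le0] also covers nonpositive
   arguments, where [ln] takes a default value. *)
have -> : i.+1 = (i.+1 - r + r)%N by have := log_star_gt0; lia.
elim: (i.+1 - r)%N => [|j IH]; first exact: iter_log_star.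
by rewrite addSn /= (le_trans (log2_le0 IH)).
Qed.

Lemma log2_scale i : log2 (scale i) <= scale i.+1.
Proof.
rewrite {1}/scale; set y := iter _ _ _; have [le_y|lt_y] := leP y 1.
  by rewrite log2_1 (le_trans ler01) // scale_ge1.
by rewrite le_max lexx orbT.
Qed.

Lemma scale0 : scale 0 = log2 n%:R.
Proof.
apply: max_r; rewrite -[leLHS](log2_2 R) /= ler_log2 //.
by rewrite -[2]/(2%:R) ler_nat.
Qed.

End Scales.

Theorem theorem18 (R : realType) :
  exists C : R,
    forall (d : Order.disp_t) (K : orderType d) (n : nat) (t t' : bst K)
           (xs : seq K) (c : nat),
      (2 <= n)%N ->
      is_bst t ->
      size_bst t = n ->
      path_balance_run t xs t' c ->
      c%:R <= C * (log2 (n%:R : R) * (log_star (n%:R : R))%:R ^+ 2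
                   * 2 ^+ log_star (n%:R : R)) * (size xs + n)%:R.
Proof.
exists 4072 => d K n t t' xs c n_ge2 _ szt run.
exact: (run_cost_le n_ge2 (log_star_gt0 R n_ge2) (scale_ge1 R n)
  (scale_last n_ge2) (log2_scale R n) (scale0 R n_ge2) szt run).
Qed.
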